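(* Let $A=\mathrm{IDD}(K^0_\infty,1,1)$ be the complex algebra with basis $e_0,e_1,e_2,\ldots$ and bilinear multiplication $e_i\diamond e_j=ij\,e_{i+j-2}$ (read as $0$ when $i=0$ or $j=0$). Then the space of derivations of $A$ is $$\mathfrak{Der}(A)=\langle\varphi,\phi\rangle,\qquad \varphi(e_i)=(i-2)e_i,\quad \phi(e_i)=i\,e_{i-1}\quad(i\ge0),$$ with $\phi(e_0)=0$.
   Context: A derivation of an algebra $(A,\diamond)$ is a linear map $D:A\to A$ with $D(a\diamond b)=D(a)\diamond b+a\diamond D(b)$ for all $a,b\in A$. $\langle S\rangle$ denotes the linear span of $S$ over $\mathbb C$. *)

(* Defs.v *)
From HB Require Import structures.
From mathcomp Require Import all_boot all_order all_algebra.
From mathcomp Require Import boolp classical_sets functions reals.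
From mathcomp Require Import complex.

Set Implicit Arguments.
Unset Strict Implicit.
Unset Printing Implicit Defensive.

Import GRing.Theory.

Local Open Scope classical_set_scope.
Local Open Scope ring_scope.

Definition lin_span (K : nzRingType) (V : lmodType K) (S : set V) : set V :=
  [set v | exists n (c : 'I_n -> K) (s : 'I_n -> V),
     (forall i, S (s i)) /\ v = \sum_(i < n) c i *: s i].

(* Derivations of the (nonassociative) algebra (V, mul), as a subset of the
   K-module V -> V with its pointwise operations. *)
Definition Der (K : nzRingType) (V : lmodType K) (mul : V -> V -> V) :
    set (V -> V) :=
  [set D | linear D /\ forall a b, D (mul a b) = mul (D a) b + mul a (D b)].

(* The space with basis e_0, e_1, ... is carried by {poly K}, with e_i = 'X^i;
   the ring product of {poly K} plays no role. *)
Definition e (K : nzRingType) (i : nat) : {poly K} := 'X^i.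
Arguments e {K} i.

Definition lin_ext (K : nzRingType) (V : lmodType K) (f : nat -> V)
    (p : {poly K}) : V :=
  \sum_(i < size p) p`_i *: f i.

(* The index i + j - 2 is truncated only when i + j < 2; then i = 0 or j = 0,
   so the coefficient i * j vanishes. *)
Definition diamond (K : nzRingType) (a b : {poly K}) : {poly K} :=
  lin_ext (fun i => lin_ext (fun j => (i * j)%N%:R *: e (i + j - 2)%N) b) a.

Definition varphi (K : nzRingType) : {poly K} -> {poly K} :=
  lin_ext (fun i => (i%:R - 2) *: e i).

Definition phi (K : nzRingType) : {poly K} -> {poly K} :=
  lin_ext (fun i => i%:R *: e i.-1).

Section Facts.
Variable K : nzRingType.
Implicit Types (p a b : {poly K}) (i j n : nat).

Lemma lin_extE (V : lmodType K) (f : nat -> V) p n :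
  (size p <= n)%N -> lin_ext f p = \sum_(i < n) p`_i *: f i.
Proof.
move=> le_pn; rewrite /lin_ext (big_ord_widen n (fun i => p`_i *: f i) le_pn).
rewrite big_mkcond; apply: eq_bigr => i _; case: ltnP => // le_pi.
by rewrite nth_default // scale0r.
Qed.

Lemma lin_ext_is_linear (V : lmodType K) (f : nat -> V) : linear (lin_ext f).
Proof.
move=> c p q; pose n := maxn (size (c *: p + q)) (maxn (size p) (size q)).
rewrite !(@lin_extE _ f _ n) ?leq_max ?leqnn ?orbT //.
rewrite scaler_sumr -big_split; apply: eq_bigr => i _ /=.
by rewrite coefD coefZ scalerDl scalerA.
Qed.

Lemma lin_ext_e (V : lmodType K) (f : nat -> V) i : lin_ext f (e i) = f i.
Proof.
rewrite /lin_ext size_polyXn big_ord_recr /= coefXn eqxx scale1r.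
rewrite big1 ?add0r // => j _.
by rewrite coefXn ltn_eqF // scale0r.
Qed.

Lemma e_basis p : p = lin_ext e p.
Proof. by rewrite /lin_ext -{1}[p]coefK poly_def. Qed.

Lemma diamond_e i j : diamond (e i) (e j) = (i * j)%N%:R *: e (i + j - 2)%N :> {poly K}.
Proof. by rewrite /diamond !lin_ext_e. Qed.

Lemma diamond_linear_l b : linear (fun a => diamond a b).
Proof. exact: lin_ext_is_linear. Qed.

End Facts.

Lemma diamond_linear_r (K : comNzRingType) (a : {poly K}) : linear (diamond a).
Proof.
move=> c p q.
have E b : diamond a b = \sum_(i < size a)
    a`_i *: lin_ext (fun j => (i * j)%N%:R *: e (i + j - 2)%N) b by [].
rewrite !E scaler_sumr -big_split; apply: eq_bigr => i _ /=.
by rewrite lin_ext_is_linear scalerDr !scalerA mulrC.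
Qed.

Lemma varphi_e (K : nzRingType) i : varphi (e i) = (i%:R - 2) *: e i :> {poly K}.
Proof. exact: lin_ext_e. Qed.

Lemma phi_e (K : nzRingType) i : phi (e i) = i%:R *: e i.-1 :> {poly K}.
Proof. exact: lin_ext_e. Qed.

(* Main.v *)
Require Import Defs.
From HB Require Import structures.
From mathcomp Require Import all_boot all_order all_algebra.
From mathcomp Require Import boolp classical_sets functions reals.
From mathcomp Require Import complex ring.

(** Identify [e i] with ['X^i].  Then the product is [a^`() * b^`()], [phi] is
    the formal derivative, and [varphi p] is ['X * p^`() - 2 *: p]
    ([diamondE], [phiE], [varphiE]); that both are derivations of the algebra is
    now an instance of the Leibniz rule.

    Conversely, let [D] be a derivation.  Since [e 1] multiplies by
    differentiation, [D (b^`()) = (D 'X)^`() * b^`() + (D b)^`()].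
    As ['X] times ['X] is [1] and [1] annihilates the algebra, [(D 'X)^`()] is
    forced to be a constant, so [D 'X = u *: 'X + m] and [D 1 = 2 * u].  The
    combination [m *: phi - u *: varphi] takes the same values at [1] and ['X],
    and subtracting it leaves a derivation that kills both.  Such a derivation is
    zero ([Der_eq0]): it commutes with differentiation, hence
    [(D 'X^2)^`() = D (2 * 'X) = 0].  So it also commutes with multiplication by
    ['X^2] in the algebra, which is twice the Euler operator ['X * b^`()]; taking
    [b = 'X^(i+1)] gives the recursion [D 'X^(i+1) = 'X * D 'X^i] after division
    by [2 * (i+1)], where characteristic zero enters.  [Der_decompose] carries
    out the subtraction. *)

Set Implicit Arguments.
Unset Strict Implicit.

Import GRing.Theory.

Local Open Scope classical_set_scope.
Local Open Scope ring_scope.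

(** * Linear maps and spans *)

Lemma linear_lin_extE (K : nzRingType) (V : lmodType K) (D : {poly K} -> V) :
  linear D -> D = lin_ext (fun i => D (e i)).
Proof.
move=> linD; pose L := GRing.isLinear.Build K {poly K} V *:%R D linD.
pose D' : {linear {poly K} -> V} := HB.pack D L.
apply/funext => p; rewrite {1}(e_basis p) /lin_ext.
rewrite -[D]/(D' : _ -> _) linear_sum.
by apply: eq_bigr => i _; rewrite linearZ.
Qed.

Lemma linear_eq_on_basis (K : nzRingType) (V : lmodType K)
    (f g : {poly K} -> V) :
  linear f -> linear g -> (forall i, f (e i) = g (e i)) -> f = g.
Proof.
move=> linf ling eqfg.
by rewrite (linear_lin_extE linf) (linear_lin_extE ling); congr lin_ext;
  apply/funext.
Qed.

Lemma lin_span_sub (K : nzRingType) (V : lmodType K) (S P : set V) :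
  P 0 -> (forall c v w, P v -> P w -> P (c *: v + w)) -> S `<=` P ->
  lin_span S `<=` P.
Proof.
move=> P0 Plin SP v [n [c [s [Ss ->]]]].
by apply: big_rec => // i w _ Pw; apply: Plin => //; apply: SP.
Qed.

Lemma lin_span_pair (K : nzRingType) (V : lmodType K) (x y : V) (a b : K) :
  lin_span [set x; y] (a *: x + b *: y).
Proof.
exists 2%N, (fun i => if i == ord0 then a else b).
exists (fun i => if i == ord0 then x else y); split; last first.
  by rewrite !big_ord_recl big_ord0 addr0.
by move=> i; case: ifP => _; [left|right].
Qed.

(** * The algebra as polynomials with product [a^`() * b^`()] *)

Section Polynomials.
Variable K : comNzRingType.
Implicit Types (a b p : {poly K}).

Lemma phiE p : phi p = p^`().
Proof.
suff -> : @phi K = (fun q => q^`()) by [].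
apply: linear_eq_on_basis; [exact: lin_ext_is_linear | exact: linearP | move=> i].
by rewrite phi_e /e derivXn scaler_nat.
Qed.

Lemma varphiE p : varphi p = 'X * p^`() - 2 *: p.
Proof.
suff -> : @varphi K = (fun q => 'X * q^`() - 2 *: q) by [].
apply: linear_eq_on_basis; first exact: lin_ext_is_linear.
  by move=> c q r; rewrite derivD derivZ -!mul_polyC; ring.
case=> [|i]; rewrite varphi_e /e derivXn scalerBl scaler_nat; first by rewrite mulr0 scale0r.
by rewrite scaler_nat mulrnAr -exprS.
Qed.

(** Both sides are bilinear, so the structure constants decide; when [i] or [j] is
    [0] the truncated exponent [i + j - 2] is multiplied by [0]. *)
Lemma diamondE a b : diamond a b = a^`() * b^`().
Proof.
have diamond_eE j (c : {poly K}) : diamond c (e j) = c^`() * (e j)^`().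
  suff /(congr1 (@^~ c)) :
    (@diamond K)^~ (e j) = (fun p => p^`() * (e j)^`()) by [].
  apply: linear_eq_on_basis; first exact: diamond_linear_l.
    by move=> k p q; rewrite linearP mulrDl -scalerAl.
  move=> i; rewrite diamond_e /e !derivXn.
  case: i j => [|i] [|j]; rewrite ?muln0 ?mul0n ?mulr0n ?scale0r ?mulr0 ?mul0r //.
  rewrite addSn addnS !subSS subn0 /= mulrnAl mulrnAr -exprD -mulrnA scaler_nat.
  by rewrite mulnC.
suff -> : diamond a = (fun p => a^`() * p^`()) by [].
apply: linear_eq_on_basis => [|k p q|j]; first exact: diamond_linear_r.
  by rewrite linearP mulrDr -scalerAr.
exact: diamond_eE.
Qed.

End Polynomials.

(** * The two derivations *)

Section Derivations.
Variable K : comNzRingType.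
Implicit Types (D E : {poly K} -> {poly K}) (c : K).

Lemma Der_comb c D E :
  Der (@diamond K) D -> Der (@diamond K) E -> Der (@diamond K) (c *: D + E).
Proof.
move=> [linD derD] [linE derE]; split=> [k p q|a b].
  rewrite -![(c *: D + E) _]/(c *: D _ + E _) linD linE !scalerDr !scalerA.
  by rewrite [c * k]mulrC addrACA.
rewrite -![(c *: D + E) _]/(c *: D _ + E _) derD derE.
by rewrite diamond_linear_l diamond_linear_r scalerDr addrACA.
Qed.

Lemma Der0 : Der (@diamond K) 0.
Proof.
by split=> [k p q|a b]; rewrite -![(0 : _ -> _) _]/(0 : {poly K}) ?scaler0 ?addr0
  // !diamondE deriv0 mul0r mulr0 addr0.
Qed.

Lemma Der_phi : Der (@diamond K) (@phi K).
Proof.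
split=> [|a b]; first exact: lin_ext_is_linear.
by rewrite !diamondE !phiE derivM.
Qed.

Lemma Der_varphi : Der (@diamond K) (@varphi K).
Proof.
split=> [|a b]; first exact: lin_ext_is_linear.
rewrite !diamondE !varphiE !derivB !derivM !derivZ derivX -!mul_polyC.
ring.
Qed.

End Derivations.

(** * Every derivation is a combination of the two *)

Section CharacteristicZero.
Variable K : idomainType.
Hypothesis charK0 : [pchar K] =i pred0.
Implicit Types (p q b : {poly K}) (D : {poly K} -> {poly K}).

Lemma mulrSn_inj n : injective (fun p : {poly K} => p *+ n.+1).
Proof.
move=> p q /= /eqP; rewrite -subr_eq0 -mulrnBl -mulr_natr mulf_eq0 subr_eq0.
by rewrite -polyC_natr polyC_eq0 (pcharf0P K).1 // orbF => /eqP.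
Qed.

Lemma deriv_eq0_const p : p^`() = 0 -> p = (p`_0)%:P.
Proof.
move=> dp0; apply/polyP => -[|i]; rewrite coefC //=; apply/eqP.
move/polyP/(_ i)/eqP: dp0; rewrite coef_deriv coef0 -mulr_natr mulf_eq0.
by rewrite (pcharf0P K).1 // orbF.
Qed.

Lemma Der_mul_deriv D : Der (@diamond K) D ->
  forall a b, D (a^`() * b^`()) = (D a)^`() * b^`() + a^`() * (D b)^`().
Proof. by move=> [_ derD] a b; rewrite -!diamondE derD. Qed.

(** A derivation is determined by its values on [e 0] and [e 1]. *)
Lemma Der_eq0 D : Der (@diamond K) D -> D 1 = 0 -> D 'X = 0 -> D = 0.
Proof.
move=> derD D1 DX; have linD := derD.1.
pose L := GRing.isLinear.Build K {poly K} {poly K} *:%R D linD.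
pose D' : {linear {poly K} -> {poly K}} := HB.pack D L.
have DMn p n : D (p *+ n) = D p *+ n by exact: (raddfMn D').
have mulD := Der_mul_deriv derD.
have D_deriv b : D b^`() = (D b)^`().
  by have := mulD 'X b; rewrite DX derivX deriv0 !mul1r mul0r add0r.
have dX2 : ('X^2 : {poly K})^`() = 'X *+ 2 by rewrite derivXn.
have dDX2 : (D 'X^2)^`() = 0 by rewrite -D_deriv dX2 DMn DX mul0rn.
apply: linear_eq_on_basis => // [k p q|i]; first by rewrite scaler0 addr0.
elim: i => [|i IHi]; first by rewrite /e expr0 D1.
(* [e 2] acts as twice the Euler operator, and [D] commutes with that action
   since the term containing [(D 'X^2)^`()] drops out. *)
have := mulD 'X^2 'X^(i.+1); rewrite dDX2 mul0r add0r -D_deriv dX2 derivXn /=.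
rewrite mulrnAl mulrnAr -exprS !DMn.
have -> : D 'X^i = 0 := IHi.
rewrite mul0rn mulr0 => D2.
apply: (mulrSn_inj (n := i)); apply: (mulrSn_inj (n := 1)).
by rewrite /= D2 !mul0rn.
Qed.

(** [D 'X] has degree at most one because [D] maps ['X] times ['X], which is [1],
    to [2 * (D 'X)^`()], and the image of the annihilating element [1] has zero
    derivative.  The two coefficients of [D 'X] are [u] and [m] up to sign. *)
Lemma Der_decompose D : Der (@diamond K) D -> exists u m : K,
  D = u *: @varphi K + m *: @phi K.
Proof.
move=> derD; have mulD := Der_mul_deriv derD.
have D1 : D 1 = (D 'X)^`() *+ 2.
  by have := mulD 'X 'X; rewrite derivX !mulr1 mul1r -mulr2n.
have d1 : (1 : {poly K})^`() = 0 by exact: (derivC 1).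
have dD1 : (D 1)^`() = 0.
  have := mulD 1 'X; rewrite derivX d1 mul0r mul0r addr0 mulr1 => <-.
  by move: (linear_lin_extE derD.1) => ->; rewrite /lin_ext size_poly0 big_ord0.
have /deriv_eq0_const dDX : ((D 'X)^`())^`() = 0.
  by apply: (@mulrSn_inj 1); rewrite /= -derivMn -D1 dD1 mul0rn.
set u := _`_0 in dDX.
have /deriv_eq0_const DX : (D 'X - u *: 'X)^`() = 0.
  by rewrite derivB derivZ derivX dDX alg_polyC subrr.
set m := _`_0 in DX.
(* At ['X] the map [varphi] takes the value [- 'X], whence the sign. *)
exists (- u), m; set F := (X in D = X).
have derF : Der (@diamond K) F.
  apply: Der_comb; first exact: Der_varphi.
  by rewrite -[_ *: _]addr0; apply: Der_comb; [exact: Der_phi | exact: Der0].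
have : - 1 *: F + D = 0.
  apply: Der_eq0; first exact: Der_comb.
    rewrite -[LHS]/(- 1 *: (- u *: varphi 1 + m *: phi 1) + D 1).
    rewrite varphiE phiE D1 dDX d1 -!mul_polyC.
    by rewrite !polyCN; ring.
  rewrite -[LHS]/(- 1 *: (- u *: varphi 'X + m *: phi 'X) + D 'X).
  rewrite varphiE phiE derivX -[D 'X](subrK (u *: 'X)) DX -!mul_polyC.
  by rewrite !polyCN; ring.
by rewrite scaleN1r addrC => /eqP; rewrite subr_eq0 => /eqP.
Qed.

End CharacteristicZero.

Theorem corollary4p8 (R : realType) :
  Der (@diamond R[i]) = lin_span [set @varphi R[i]; @phi R[i]].
Proof.
apply/seteqP; split=> [D derD|].
  have [u [m ->]] := Der_decompose (Num.Theory.pchar_num _) derD.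
  exact: lin_span_pair.
apply: lin_span_sub; first exact: Der0.
  by move=> c D E; apply: Der_comb.
by move=> _ [->|->]; [exact: Der_varphi | exact: Der_phi].
Qed.
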